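(* For $pq\ne0$ and $h\ge0$ define $$R_h(x;p,q)=\left[\prod_{k=0}^{h}P_k\!\left(q^{2k-3}px,\tfrac{p^2}{q^2}\right)^2\right]P_{h+1}\!\left(q^{2h-1}px,\tfrac{p^2}{q^2}\right),$$ and set $R_{-1}(x;p,q)=1$. Then for every $h\ge0$, $$R_h(x;p,q)=R_h(x;q,p),$$ and for every $N\ge0$ the height-truncated generating function $G_N(x,y,p,q)=\sum_{\pi\in\mathcal D,\ h(\pi)\le N}x^{n(\pi)}y^{h(\pi)}p^{w(\pi)}q^{a(\pi)}$ satisfies $$G_N(x,y,p,q)=\sum_{h=0}^{N}x^hy^hq^{h^2}\,\frac{R_{h-1}(p^2x;p,q)}{R_h(x;p,q)}.$$
   Context: A Dyck path is a lattice path starting at $(0,0)$, with steps $U=(1,1)$ and $D=(1,-1)$, ending on the line $y=0$ and never visiting a vertex with negative $y$-coordinate; $\mathcal D$ is the set of all Dyck paths (including the empty path). For $\pi\in\mathcal D$ with $2n$ steps, $n(\pi)=n$ is the semi-length; the height $h(\pi)$ is the maximum $y$-coordinate; the proper area $a(\pi)$ is the sum of the starting heights of all steps. Water capacity $w(\pi)$: let $h=h(\pi)$. For each $1\le k\le h$ mark the first up-step $U_k$ of $\pi$ from level $k-1$ to $k$ and the last down-step $D_k$ from level $k$ to $k-1$; they occur in the order $U_1,\dots,U_h,D_h,\dots,D_1$. The portions of $\pi$ strictly between consecutive marked steps are the gaps: for $1\le k<h$ a left gap at level $k$ (between $U_k$ and $U_{k+1}$) and a right gap at level $k$ (between $D_{k+1}$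 and $D_k$), and a single top gap at level $h$ (between $U_h$ and $D_h$). A gap at level $k$ starts and ends at height $k$ and never rises above height $k$; reflecting it in the line $y=k$ and translating to the horizontal axis gives a Dyck path of height at most $k$. Then $w(\pi)$ is the sum over all gaps of the proper areas of these reflected Dyck paths (and $w=0$ for the empty path). For $h\ge0$, $P_h(X,Q)=\sum_{m=0}^{\lfloor h/2\rfloor}(-X)^mQ^{m(m-1)}\begin{bmatrix} h-m \\ m \end{bmatrix}_Q$, where $\begin{bmatrix} N \\ m \end{bmatrix}_Q$ is the Gaussian binomial polynomial in $Q$ (so $P_0=P_1=1$). Identities involving $G_N$ are identities of formal power series in $x$. *)

(* Defs.v *)
From HB Require Import structures.
From mathcomp Require Import all_boot all_order all_algebra.
From mathcomp Require Import boolp.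

Set Implicit Arguments.
Unset Strict Implicit.
Unset Printing Implicit Defensive.

Import GRing.Theory.
Local Open Scope ring_scope.

(** * Formal power series in one variable over a field *)

Record fps (F : fieldType) := FPS { coefs : nat -> F }.
Arguments FPS {F} coefs.
Arguments coefs {F} f n : rename.

Section FormalPowerSeries.
Variable F : fieldType.
Implicit Types f g h : fps F.

Lemma fpsP f g : (forall n, coefs f n = coefs g n) -> f = g.
Proof. by case: f g => [f] [g] /= fg; congr FPS; apply: funext. Qed.

HB.instance Definition _ := gen_eqMixin (fps F).
HB.instance Definition _ := gen_choiceMixin (fps F).

Definition fps_zero : fps F := FPS (fun _ => 0).
Definition fps_opp f : fps F := FPS (fun n => - coefs f n).
Definition fps_add f g : fps F := FPS (fun n => coefs f n + coefs g n).
Definition fps_one : fps F := FPS (fun n => (n == 0)%:R).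
Definition fps_mul f g : fps F :=
  FPS (fun n => \sum_(i < n.+1) coefs f i * coefs g (n - i)).
Definition fps_scale (c : F) f : fps F := FPS (fun n => c * coefs f n).

Fact fps_addA : associative fps_add.
Proof. by move=> f g h; apply: fpsP => n /=; rewrite addrA. Qed.
Fact fps_addC : commutative fps_add.
Proof. by move=> f g; apply: fpsP => n /=; rewrite addrC. Qed.
Fact fps_add0 : left_id fps_zero fps_add.
Proof. by move=> f; apply: fpsP => n /=; rewrite add0r. Qed.
Fact fps_addN : left_inverse fps_zero fps_opp fps_add.
Proof. by move=> f; apply: fpsP => n /=; rewrite addNr. Qed.

HB.instance Definition _ :=
  GRing.isZmodule.Build (fps F) fps_addA fps_addC fps_add0 fps_addN.

Definition fps_trunc m f : {poly F} := \poly_(i < m.+1) coefs f i.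

Lemma coef_fps_trunc m f i : (i <= m)%N -> (fps_trunc m f)`_i = coefs f i.
Proof. by move=> im; rewrite coef_poly ltnS im. Qed.

Lemma coefs_mul_trunc m f g n : (n <= m)%N ->
  coefs (fps_mul f g) n = (fps_trunc m f * fps_trunc m g)`_n.
Proof.
move=> nm; rewrite coefM /=; apply: eq_bigr => i _.
have im : (i <= m)%N by rewrite (leq_trans _ nm) // -ltnS.
by rewrite !coef_fps_trunc // (leq_trans (leq_subr _ _)).
Qed.

Fact fps_mulA : associative fps_mul.
Proof.
move=> f g h; apply: fpsP => n.
transitivity ((fps_trunc n f * (fps_trunc n g * fps_trunc n h))`_n).
  rewrite [RHS]coefM; apply: eq_bigr => i _.
  by rewrite (coefs_mul_trunc _ _ (leq_subr i n)) coef_fps_trunc // -ltnS.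
rewrite mulrA [LHS]coefM; apply: eq_bigr => i _.
have im : (i <= n)%N by rewrite -ltnS.
by rewrite (coefs_mul_trunc _ _ im) coef_fps_trunc // leq_subr.
Qed.

Fact fps_mulC : commutative fps_mul.
Proof.
by move=> f g; apply: fpsP => n; rewrite !(coefs_mul_trunc _ _ (leqnn n)) mulrC.
Qed.

Fact fps_mul1 : left_id fps_one fps_mul.
Proof.
move=> f; apply: fpsP => n /=; rewrite big_ord_recl /= mul1r subn0 big1 ?addr0 //.
by move=> i _; rewrite mul0r.
Qed.

Fact fps_mulDl : left_distributive fps_mul fps_add.
Proof.
move=> f g h; apply: fpsP => n /=; rewrite -big_split /=.
by apply: eq_bigr => i _; rewrite mulrDl.
Qed.

Fact fps_one_neq0 : fps_one != 0.
Proof.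
apply/eqP => /(congr1 (fun f => coefs f 0)) /= /eqP.
by rewrite oner_eq0.
Qed.

HB.instance Definition _ := GRing.Zmodule_isComNzRing.Build (fps F)
  fps_mulA fps_mulC fps_mul1 fps_mulDl fps_one_neq0.

Fact fps_scaleA a b f : fps_scale a (fps_scale b f) = fps_scale (a * b) f.
Proof. by apply: fpsP => n /=; rewrite mulrA. Qed.
Fact fps_scale1 : left_id 1 fps_scale.
Proof. by move=> f; apply: fpsP => n /=; rewrite mul1r. Qed.
Fact fps_scaleDr : right_distributive fps_scale +%R.
Proof. by move=> a f g; apply: fpsP => n /=; rewrite mulrDr. Qed.
Fact fps_scaleDl f : {morph fps_scale^~ f : a b / a + b}.
Proof. by move=> a b; apply: fpsP => n /=; rewrite mulrDl. Qed.

HB.instance Definition _ := GRing.Zmodule_isLmodule.Build F (fps F)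
  fps_scaleA fps_scale1 fps_scaleDr fps_scaleDl.

Fact fps_scaleAl (a : F) f g : a *: (f * g) = (a *: f) * g.
Proof.
apply: fpsP => n /=; rewrite mulr_sumr.
by apply: eq_bigr => i _; rewrite mulrA.
Qed.

HB.instance Definition _ := GRing.Lmodule_isLalgebra.Build F (fps F) fps_scaleAl.
HB.instance Definition _ := GRing.Lalgebra_isComAlgebra.Build F (fps F).

(** The first [n] coefficients of the inverse of [f] when [coefs f 0 != 0];
    a series with zero constant term is not a unit, and is its own [^-1], as
    usual for a [unitRingType]. *)
Fixpoint fps_inv_seq f n : seq F :=
  if n is n'.+1 then
    let s := fps_inv_seq f n' in
    rcons s ((coefs f 0)^-1 *
             ((n' == 0)%:R - \sum_(i < n') coefs f i.+1 * s`_(n' - i.+1)))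
  else [::].

Definition fps_unit : pred (fps F) := fun f => coefs f 0 != 0.
Definition fps_inv f : fps F :=
  if fps_unit f then FPS (fun n => (fps_inv_seq f n.+1)`_n) else f.

Lemma size_fps_inv_seq f n : size (fps_inv_seq f n) = n.
Proof. by elim: n => //= n IHn; rewrite size_rcons IHn. Qed.

Lemma nth_fps_inv_seq f n m : (m < n)%N ->
  (fps_inv_seq f n)`_m = (fps_inv_seq f m.+1)`_m.
Proof.
elim: n => // n IHn; rewrite ltnS leq_eqVlt => /predU1P[-> // | mn].
by rewrite [fps_inv_seq f n.+1]/= nth_rcons size_fps_inv_seq mn IHn.
Qed.

Fact fps_mulVr : {in fps_unit, left_inverse 1 fps_inv *%R}.
Proof.
move=> f uf; have f0 : coefs f 0 != 0 by [].
rewrite mulrC /fps_inv ifT //; apply: fpsP => n.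
rewrite [LHS]/= big_ord_recl subn0 [(rcons _ _)`_n]nth_rcons size_fps_inv_seq.
rewrite ltnn eqxx mulrA divff // mul1r.
rewrite [X in _ + X](_ : _ =
  \sum_(i < n) coefs f i.+1 * (fps_inv_seq f n)`_(n - i.+1)) ?subrK //.
apply: eq_bigr => i _; congr (_ * _).
by rewrite [RHS]nth_fps_inv_seq // ltn_subrL (leq_ltn_trans _ (ltn_ord i)).
Qed.

Fact fps_unitP f g : g * f = 1 -> fps_unit f.
Proof.
move/(congr1 (fun h => coefs h 0)); rewrite /= big_ord1 /= => gf.
by apply/eqP => f0; move/eqP: gf; rewrite f0 mulr0 eq_sym oner_eq0.
Qed.

Fact fps_invr_out : {in [predC fps_unit], fps_inv =1 id}.
Proof. by move=> f nuf; rewrite /fps_inv ifN. Qed.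

HB.instance Definition _ := GRing.ComNzRing_hasMulInverse.Build (fps F)
  fps_mulVr fps_unitP fps_invr_out.

Definition fpsX : fps F := FPS (fun n => (n == 1)%:R).

End FormalPowerSeries.

(** * Dyck paths

    A path is a word of steps, [true] being U = (1,1) and [false] being
    D = (1,-1); step number [i] (from 0) starts at the endpoint of
    [take i s]. *)

Definition ycoord (s : seq bool) : int := \sum_(b <- s) (if b then 1 else -1).

Definition is_dyck (s : seq bool) : bool :=
  [forall i : 'I_(size s).+1, 0 <= ycoord (take i s)] && (ycoord s == 0).

(** [ycoord] is nonnegative along a Dyck path, so [absz] loses nothing there. *)
Definition level (s : seq bool) (i : nat) : nat := `|ycoord (take i s)|%N.

Definition height (s : seq bool) : nat := (\max_(i < (size s).+1) level s i)%N.

Definition area (s : seq bool) : nat := (\sum_(i < size s) level s i)%N.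

(** Positions of the marked steps U_k and D_k, for [1 <= k <= height s]; the
    defaults for other [k] are never used. *)
Definition posU (s : seq bool) (k : nat) : nat :=
  find (fun i => nth false s i && (level s i == k.-1)) (iota 0 (size s)).
Definition posD (s : seq bool) (k : nat) : nat :=
  (\max_(i < size s | ~~ nth true s i && (level s i == k)) i)%N.

(** The steps strictly between positions [i] and [j], with U and D exchanged:
    the reflected gap, moved to the horizontal axis. *)
Definition reflected_gap (s : seq bool) (i j : nat) : seq bool :=
  map negb (take (j - i.+1) (drop i.+1 s)).

Definition water (s : seq bool) : nat :=
  let h := height s in
  if h == 0%N then 0%N else
  (\sum_(1 <= k < h)
      (area (reflected_gap s (posU s k) (posU s k.+1)) +
       area (reflected_gap s (posD s k.+1) (posD s k))) +
   area (reflected_gap s (posU s h) (posD s h)))%N.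

(** * The height-truncated generating function, as a power series in [x] *)

Definition G (F : fieldType) (N : nat) (y p q : F) : fps F :=
  FPS (fun n =>
    \sum_(s : (n.*2).-tuple bool | is_dyck s && (height s <= N)%N)
      y ^+ height s * p ^+ water s * q ^+ area s).

(** * The polynomials P_h and R_h *)

(** Gaussian binomial [N choose m] at [Q], by the q-Pascal rule so that it
    makes sense when [Q] is a root of unity; [gauss_binP] is the product
    formula. *)
Fixpoint gauss_bin (A : comNzRingType) (Q : A) (N m : nat) : A :=
  match N, m with
  | _, 0 => 1
  | 0, _.+1 => 0
  | N'.+1, m'.+1 => gauss_bin Q N' m' + Q ^+ m'.+1 * gauss_bin Q N' m'.+1
  end.

Lemma gauss_binP (A : comNzRingType) (Q : A) (N m : nat) :
  gauss_bin Q N m * \prod_(i < m) (1 - Q ^+ i.+1)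
  = \prod_(i < m) (1 - Q ^+ (N - i)).
Proof.
elim: N m => [|N IHN] [|m] //=; rewrite ?big_ord0 ?mul1r //.
  by rewrite mul0r big_ord_recl /= expr0 subrr mul0r.
rewrite mulrDl big_ord_recr /= mulrA IHN -mulrA.
have := IHN m.+1; rewrite big_ord_recr /= => ->.
rewrite [RHS]big_ord_recl subn0 [X in _ + _ * X]big_ord_recr /=.
rewrite (eq_bigr (fun i : 'I_m => 1 - Q ^+ (N - i))) //.
set B := \prod_(i < m) _; case: (leqP m N) => mN.
  rewrite mulrCA -mulrDr mulrC; congr (_ * _).
  by rewrite mulrBr mulr1 -exprD addSn subnKC // addrA subrK.
have -> : B = 0.
  by rewrite /B (bigD1 (Ordinal mN)) //= subnn subrr mul0r.
by rewrite !(mul0r, mulr0) addr0.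
Qed.

Definition Ppoly (A : comNzRingType) (h : nat) (X Q : A) : A :=
  \sum_(m < (h./2).+1)
    (- X) ^+ m * Q ^+ (m * m.-1) * gauss_bin Q (h - m) m.

(** Only the indices [h >= -1] are meaningful, with R_{-1} = 1. The series variable
    [x] and the scalars [p], [q] live in an algebra and in its base field. *)
Definition Rpoly (F : fieldType) (A : comAlgType F) (h : int) (x : A) (p q : F) : A :=
  if h is Posz n then
    (\prod_(k < n.+1)
       Ppoly k ((q ^ (2 * k%:Z - 3) * p) *: x) (p ^+ 2 / q ^+ 2)%:A ^+ 2)
    * Ppoly n.+1 ((q ^ (2 * n%:Z - 1) * p) *: x) (p ^+ 2 / q ^+ 2)%:A
  else 1.

(** The denominators of the expansion of [G] are invertible power series. *)
Lemma Ppoly_coef0 (F : fieldType) (h : nat) (a b : F) :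
  coefs (Ppoly h (a *: fpsX F) b%:A) 0 = 1.
Proof.
pose c0 (f : fps F) := coefs f 0.
have c0M f g : c0 (f * g) = c0 f * c0 g by rewrite /c0 /= big_ord1.
have c0D : {morph c0 : f g / f + g} by [].
rewrite /Ppoly big_ord_recl -/(c0 _) c0D.
rewrite !expr0 !mul1r subn0 [X in c0 X](_ : _ = 1); last by case: (h).
rewrite (big_morph c0 c0D erefl) big1 ?addr0 // => i _.
by rewrite exprS !c0M /c0 /= mulr0 oppr0 !mul0r.
Qed.

Lemma Rpoly_unit (F : fieldType) (h : int) (c p q : F) :
  Rpoly h (c *: fpsX F) p q \is a GRing.unit.
Proof.
have Pu k (a : F) : Ppoly k (a *: (c *: fpsX F)) (p ^+ 2 / q ^+ 2)%:A
    \is a GRing.unit.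
  rewrite scalerA; have := Ppoly_coef0 k (a * c) (p ^+ 2 / q ^+ 2).
  by move=> e; rewrite unfold_in /= /fps_unit e oner_neq0.
case: h => [n|n]; last exact: unitr1.
rewrite unitrM Pu andbT; apply: (big_ind (fun f => f \is a GRing.unit)).
- exact: unitr1.
- by move=> f g uf ug; rewrite unitrM uf.
- by move=> k _; rewrite unitrX.
Qed.

(* Main.v *)
Require Import Defs.
From mathcomp Require Import all_boot all_order all_algebra.
From mathcomp Require Import zify ring.

Set Implicit Arguments.
Unset Strict Implicit.
Unset Printing Implicit Defensive.

Import Order.TTheory GRing.Theory Num.Theory.
Local Open Scope ring_scope.

(** The symmetry holds factor by factor: inverting the base of a Gaussian
    binomial only costs a monomial, and the exponents [2k-3] are chosen so that
    [P_k(q^(2k-3) p x, p^2/q^2)] becomes symmetric in [p] and [q].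

    For the expansion, cut a path at its marked steps.  A gap of level [k] and
    semi-length [m] whose reflection has area [a] contributes [p^a q^(2mk-a)],
    and the marked steps contribute [x^h q^(h^2)], so the paths of height [h]
    have generating function
    [x^h q^(h^2) Gamma_h(x) \prod_(k < h) Gamma_k(x)^2], where [Gamma_k] counts
    the gaps of level [k].  Splitting a gap at its first return gives
    [Gamma_k(x) = 1 + p q^(2k-1) x Gamma_(k-1)(p^2 x) Gamma_k(x)]; by the
    q-Pascal rule this continued fraction has the convergents
    [Gamma_k(x) = P_k(q^(2k-3) p^3 x) / P_(k+1)(q^(2k-1) p x)], in base
    [p^2/q^2], and the product telescopes to the quotient of the [R]'s. *)

(** * The polynomials P_h *)

Lemma gauss_bin_small (A : comNzRingType) (Q : A) N m :
  (N < m)%N -> gauss_bin Q N m = 0.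
Proof.
elim: N m => [|N IHN] [|m] //= Nm.
by rewrite !IHN ?mulr0 ?addr0 // ltnW.
Qed.

(** The mirror of the defining rule, with the power of [Q] on the other term. Inverting [Q]
    exchanges the two rules, which drives [gauss_bin_inv]. *)
Lemma gauss_bin_pascal (A : comNzRingType) (Q : A) N m :
  gauss_bin Q N.+1 m.+1 =
  Q ^+ (N - m) * gauss_bin Q N m + gauss_bin Q N m.+1.
Proof.
elim: N m => [|N IHN] m; first by case: m => [|m] /=;
  rewrite ?mulr0 ?addr0 ?mulr1 ?expr0 // mul1r.
rewrite [LHS]/= -/(gauss_bin Q N.+1 m.+1) [in LHS](IHN m).
case: m => [|m].
  rewrite [gauss_bin Q N.+1 1]/= subn0 expr1 !mulr1 subn0.
  have -> : gauss_bin Q N 0 = 1 by case: (N).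
  by rewrite exprS; ring.
rewrite -/(gauss_bin Q N.+1 m.+1) [X in X + _](IHN m).
rewrite -/(gauss_bin Q N.+1 m.+1) -/(gauss_bin Q N.+1 m.+2).
have -> : gauss_bin Q N.+1 m.+2 =
  gauss_bin Q N m.+1 + Q ^+ m.+2 * gauss_bin Q N m.+2 by [].
have -> : gauss_bin Q N.+1 m.+1 =
  gauss_bin Q N m + Q ^+ m.+1 * gauss_bin Q N m.+1 by [].
rewrite subSS; case: (ltnP m N) => [mN|Nm].
  rewrite (_ : (N - m = (N - m.+1).+1)%N); last by lia.
  by rewrite !exprS; ring.
by rewrite !(@gauss_bin_small _ _ N m.+1) //; ring.
Qed.

(** The Gaussian binomial is a palindromic polynomial in [Q] of degree [m * (N - m)]. *)
Lemma gauss_bin_inv (F : fieldType) (Q : F) N m : Q != 0 -> (m <= N)%N ->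
  gauss_bin Q N m = Q ^+ (m * (N - m)) * gauss_bin Q^-1 N m.
Proof.
move=> Q0; elim: N m => [|N IHN] [|m] //= mN; try by rewrite expr0 mul1r.
have mN' : (m <= N)%N by [].
rewrite -/(gauss_bin Q N.+1 m.+1) gauss_bin_pascal (IHN m) //.
rewrite subSS mulrDr; congr (_ + _).
  by rewrite mulrA -exprD mulSn.
case: (ltnP m N) => [lt|ge]; last by rewrite !gauss_bin_small ?mulr0.
rewrite IHN // mulrA exprVn; congr (_ * _).
have -> : (m.+1 * (N - m) = m.+1 * (N - m.+1) + m.+1)%N.
  by rewrite -mulnSr; congr (_ * _)%N; lia.
by rewrite exprD mulfK // expf_neq0.
Qed.

(** * Coefficients of P_k: symmetry in [p] and [q], and the recurrence *)

Lemma gauss_bin_alg (F : fieldType) (A : comAlgType F) (b : F) N m :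
  gauss_bin (b%:A : A) N m = (gauss_bin b N m)%:A.
Proof.
elim: N m => [|N IHN] [|m]; rewrite ?scale1r ?scale0r //=.
by rewrite !IHN scalerDl -[b%:A ^+ _](rmorphXn (in_alg A)) -scalerAl mul1r scalerA.
Qed.

Lemma Ppoly_alg (F : fieldType) (A : comAlgType F) k (a b : F) (x : A) :
  Ppoly k (a *: x) b%:A =
  \sum_(m < (k./2).+1)
    ((- a) ^+ m * b ^+ (m * m.-1) * gauss_bin b (k - m) m) *: x ^+ m.
Proof.
apply: eq_bigr => m _.
rewrite gauss_bin_alg -scaleNr exprZn -[b%:A ^+ _](rmorphXn (in_alg A)).
by rewrite !mulr_algr !scalerA; congr (_ *: _); ring.
Qed.

Lemma Ppoly_sym (F : fieldType) (A : comAlgType F) k (p q : F) (x : A) :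
  p != 0 -> q != 0 ->
  Ppoly k ((q ^ (2 * k%:Z - 3) * p) *: x) (p ^+ 2 / q ^+ 2)%:A =
  Ppoly k ((p ^ (2 * k%:Z - 3) * q) *: x) (q ^+ 2 / p ^+ 2)%:A.
Proof.
move=> p0 q0; rewrite !Ppoly_alg; apply: eq_bigr => -[m /= mk] _.
congr (_ *: _); case: m mk => [|m] mk.
  by rewrite mul0n !expr0 !mul1r subn0; case: (k).
(* For a positive power of [x] the summation range forces k >= 2(m+1), so 2k-3 is the natural number
   2(2m+d)+1. *)
have {mk} [d ->] : exists d, k = (m.+1.*2 + d)%N.
  by exists (k - m.+1.*2)%N; have := odd_double_half k; lia.
rewrite (gauss_bin_inv (Q := p ^+ 2 / q ^+ 2)); last by lia.
  2: by rewrite mulf_neq0 ?invr_neq0 ?expf_neq0.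
rewrite invf_div mulrA; congr (_ * _).
have -> : 2 * (m.+1.*2 + d)%N%:Z - 3 = (2 * (m + m + d) + 1)%N%:Z by lia.
rewrite -!exprnP succnK.
have -> : (m.+1.*2 + d - m.+1 - m.+1 = d)%N by lia.
(* Every remaining factor is an (m+1)-st power, so comparing the bases suffices. *)
rewrite (mulnC m.+1 m) (mulnC m.+1 d) !exprM -!exprMn; congr (_ ^+ _).
rewrite !expr_div_n -!exprM !mul2n -!addnn !exprD !expr1.
field.
by rewrite !expf_neq0.
Qed.

(** The extra terms have k-m < m and vanish. This gives the three sums of the recurrence matching
    ranges. *)
Lemma Ppoly_widen (A : comNzRingType) (X Q : A) k M : (k./2 <= M)%N ->
  Ppoly k X Q =
  \sum_(m < M.+1) (- X) ^+ m * Q ^+ (m * m.-1) * gauss_bin Q (k - m) m.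
Proof.
move=> kM; rewrite /Ppoly.
pose f m := (- X) ^+ m * Q ^+ (m * m.-1) * gauss_bin Q (k - m) m.
rewrite -!(big_mkord xpredT f) [RHS](big_cat_nat (n := (k./2).+1)) //=.
rewrite [X in _ = _ + X]big_nat_cond [X in _ = _ + X]big1 ?addr0 //.
move=> i; rewrite andbT => /andP[ki _]; rewrite /f gauss_bin_small ?mulr0 //.
have := odd_double_half k; lia.
Qed.

(** In the term of index i+1 the defining Pascal rule splits the binomial: the part carrying Q^(i+1)
    rescales [X] by [Q], and in the other part Q^((i+1)i) = Q^(2i) Q^(i(i-1)) rescales it by Q^2. *)
Lemma Ppoly_rec (A : comNzRingType) (X Q : A) k :
  Ppoly k.+2 X Q = Ppoly k.+1 (X * Q) Q - X * Ppoly k (X * Q ^+ 2) Q.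
Proof.
rewrite (@Ppoly_widen _ _ _ k.+2 k.+1); last by have := odd_double_half k; lia.
rewrite (@Ppoly_widen _ _ _ k.+1 k.+1); last by have := odd_double_half k.+1; lia.
rewrite (@Ppoly_widen _ _ _ k k); last by have := odd_double_half k; lia.
rewrite big_ord_recl [X in _ = X - _]big_ord_recl /= !expr0 !mul1r.
rewrite -addrA mulr_sumr -sumrB; congr (_ + _); apply: eq_bigr => -[i /= ik] _.
have -> : (k.+2 - bump 0 i = (k - i).+1)%N by rewrite /bump; lia.
rewrite /bump /= !add1n subSS.
rewrite -!mulNr !exprMn !exprS.
have -> : (i.+1 * i = 2 * i + i * i.-1)%N.
  by case: i {ik} => //= i; lia.
rewrite !add0n mul2n -addnn !exprD; ring.
Qed.

(** The last factor belongs to the same family as the others, at index h+1, so symmetry and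
    telescoping treat all factors alike. *)
Lemma RpolyE (F : fieldType) (A : comAlgType F) (h : nat) (x : A) (p q : F) :
  Rpoly h%:Z x p q =
  (\prod_(k < h.+1)
     Ppoly k ((q ^ (2 * k%:Z - 3) * p) *: x) (p ^+ 2 / q ^+ 2)%:A ^+ 2)
  * Ppoly h.+1 ((q ^ (2 * h.+1%:Z - 3) * p) *: x) (p ^+ 2 / q ^+ 2)%:A.
Proof. by rewrite (_ : 2 * h.+1%:Z - 3 = 2 * h%:Z - 1); last lia. Qed.

(** * Decomposition of paths *)

Section Paths.
Implicit Types (s u v w : seq bool) (lo hi m c : int).

(** * Levels along a word, passage cuts and areas *)

Definition stepz (b : bool) : int := if b then 1 else -1.

Lemma ycoord_nil : ycoord [::] = 0.
Proof. exact: big_nil. Qed.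

Lemma ycoord_cons b s : ycoord (b :: s) = stepz b + ycoord s.
Proof. exact: big_cons. Qed.

Lemma ycoord_cat u v : ycoord (u ++ v) = ycoord u + ycoord v.
Proof. exact: big_cat. Qed.

Lemma ycoord_even s : ycoord s = 0 -> ~~ odd (size s).
Proof.
suff: exists z : int, ycoord s = 2 * z + (size s)%:Z by case=> z ->; lia.
elim: s => [|b s [z IH]]; first by exists 0; rewrite ycoord_nil.
exists (if b then z else z - 1).
by rewrite ycoord_cons IH /= /stepz; case: b; lia.
Qed.

Fixpoint within lo hi c s : bool :=
  (lo <= c <= hi) && (if s is b :: s' then within lo hi (c + stepz b) s' else true).

Lemma withinP lo hi c s :
  reflect (forall i, (i <= size s)%N -> lo <= c + ycoord (take i s) <= hi)
          (within lo hi c s).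
Proof.
elim: s c => [|b s IH] c /=.
  rewrite andbT; apply: (iffP idP) => [h i|/(_ 0%N isT)].
    by rewrite ycoord_nil addr0.
  by rewrite ycoord_nil addr0.
apply: (iffP andP) => [[h /IH hs] [|i] si|h].
- by rewrite take0 ycoord_nil addr0.
- by rewrite /= ycoord_cons addrA; apply: hs.
split; first by have := h 0%N isT; rewrite take0 ycoord_nil addr0.
by apply/IH => i si; have := h i.+1 si; rewrite /= ycoord_cons addrA.
Qed.

Lemma within_start lo hi c s : within lo hi c s -> lo <= c <= hi.
Proof. by case: s => [|b s] /andP[]. Qed.

Lemma within_cat lo hi c u v :
  within lo hi c (u ++ v) = within lo hi c u && within lo hi (c + ycoord u) v.
Proof.
elim: u c => [|b u IH] c /=; last by rewrite IH ycoord_cons addrA andbA.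
rewrite ycoord_nil addr0 andbT; apply/idP/andP => [h|[]//].
by split=> //; apply: within_start h.
Qed.

Lemma within_weak lo hi lo' hi' c s : lo' <= lo -> hi <= hi' ->
  within lo hi c s -> within lo' hi' c s.
Proof.
move=> h1 h2 /withinP h; apply/withinP => i /h /andP[h3 h4].
by rewrite (le_trans h1 h3) (le_trans h4 h2).
Qed.

Lemma within_end lo hi c s : within lo hi c s -> lo <= c + ycoord s <= hi.
Proof. by move/withinP/(_ _ (leqnn _)); rewrite take_size. Qed.

(** The cut is at the first step rising above [m]. *)
Lemma first_passage lo hi m c w : within lo hi c w -> c <= m ->
  ~~ within lo m c w ->
  exists u v, [/\ w = u ++ true :: v, c + ycoord u = m & within lo m c u].
Proof.
elim: w c => [|b w IH] c /=; first by rewrite !andbT => /andP[-> _] ->.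
case/andP=> /andP[lc _] hw cm; rewrite lc cm /= => nw.
have [cm1|cm1] := lerP (c + stepz b) m.
  have [u [v [-> um wu]]] := IH _ hw cm1 nw.
  by exists (b :: u), v; rewrite ycoord_cons addrA /= lc cm.
have [-> ->] : b = true /\ c = m by move: cm1; rewrite /stepz; case: b {hw nw}; lia.
exists [::], w; rewrite ycoord_nil addr0 /= andbT; split=> //; lia.
Qed.

(** The cut is at the last step coming down to [m]. *)
Lemma last_passage lo hi m c w : within lo hi c w -> c + ycoord w <= m ->
  ~~ within lo m c w ->
  exists u v, [/\ w = u ++ false :: v, c + ycoord u = m + 1 & within lo m m v].
Proof.
elim: w c => [|b w IH] c /=.
  by rewrite ycoord_nil addr0 !andbT => /andP[-> _] ->.
case/andP=> /andP[lc _] hw; rewrite ycoord_cons addrA => em nw.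
(* The cut falls at the first letter after which the rest stays at or below [m]; while the rest
   still exceeds [m], it lies further on. *)
have [hm|/IH] := boolP (within lo m (c + stepz b) w); last first.
  move=> /(_ hw em) [u [v [-> um wv]]].
  by exists (b :: u), v; rewrite ycoord_cons addrA.
have := within_start hm; move: nw; rewrite lc hm /= andbT => nw hm'.
have [b0 cm] : b = false /\ c = m + 1.
  by move: nw hm'; rewrite /stepz; case: b {hw em hm}; lia.
move: hm; rewrite b0 cm /stepz addrK => hm.
by exists [::], w; rewrite ycoord_nil addr0.
Qed.

(** The starting level is a parameter so that areas of factors of a path add up. *)
Fixpoint asum c s : nat :=
  if s is b :: s' then (absz c + asum (c + stepz b) s')%N else 0%N.

Lemma asum_cat c u v : asum c (u ++ v) = (asum c u + asum (c + ycoord u) v)%N.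
Proof.
elim: u c => [|b u IH] c /=; first by rewrite ycoord_nil addr0.
by rewrite IH ycoord_cons addrA addnA.
Qed.

Lemma asumE c s : asum c s = (\sum_(i < size s) absz (c + ycoord (take i s))%R)%N.
Proof.
elim: s c => [|b s IH] c /=; first by rewrite big_ord0.
rewrite big_ord_recl take0 ycoord_nil addr0 IH; congr (_ + _)%N.
by apply: eq_bigr => i _; rewrite /= ycoord_cons addrA.
Qed.

Lemma areaE s : area s = asum 0 s.
Proof. by rewrite asumE; apply: eq_bigr => i _; rewrite add0r. Qed.

Lemma ycoord_neg s : ycoord (map negb s) = - ycoord s.
Proof.
elim: s => [|b s IH]; rewrite ?ycoord_nil ?oppr0 //= !ycoord_cons IH.
by rewrite /stepz; case: b => /=; lia.
Qed.

(** Below the ceiling [hi] the reflected heights are nonnegative, so raising the reflected word by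
    one adds one per step. This is the origin of the substitution x -> p^2 x. *)
Lemma asum_neg_shift hi c s : within 0 hi c s ->
  asum (hi - c + 1) (map negb s) = (asum (hi - c) (map negb s) + size s)%N.
Proof.
elim: s c => [|b s IH] c //= /andP[ch /IH].
have -> : hi - (c + stepz b) = hi - c + stepz (~~ b).
  by rewrite /stepz; case: b; rewrite /= ?opprD addrA ?opprK.
by rewrite addrAC => ->; lia.
Qed.

Lemma height_leE N s : is_dyck s && (height s <= N)%N =
  within 0 N%:Z 0 s && (ycoord s == 0).
Proof.
rewrite /is_dyck andbAC; congr (_ && _); apply/andP/withinP.
  case=> /forallP h /bigmax_leqP hN i si.
  have := h (Ordinal (n := (size s).+1) si); have := hN (Ordinal (n := (size s).+1) si) isT.
  by rewrite /level /=; lia.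
move=> h; split; first by apply/forallP=> i; case/andP: (h i (ltn_ord i)); rewrite add0r.
by apply/bigmax_leqP => i _; have := h i (ltn_ord i); rewrite /level; lia.
Qed.

(* Heights are absolute: a word is read from the starting level [k], and
   [peaked k r] describes the part of a path of height [k + r] between the
   steps U_k and D_k; in [gapped k r w a], [a] is the water it holds. *)
Definition isgap k w := within 0 k k w && (ycoord w == 0).

Definition peaked k r w :=
  [&& within 0 (k + r) k w, ~~ within 0 (k + r - 1) k w & ycoord w == 0].

Inductive gapped : nat -> nat -> seq bool -> nat -> Prop :=
| gapped_top k t : isgap k%:Z t -> gapped k 0 t (area (map negb t))
| gapped_step k r L R w a : isgap k%:Z L -> isgap k%:Z R -> gapped k.+1 r w a ->
    gapped k r.+1 (L ++ true :: w ++ false :: R)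
      (area (map negb L) + area (map negb R) + a).

(** Induction on the number of levels left: cut at the first U leaving level [k] upwards and at the
    last D returning to it. *)
Lemma peaked_gapped k r w : peaked k%:Z r%:Z w -> exists a, gapped k r w a.
Proof.
elim: r k w => [|r IH] k w /and3P[hw nw /eqP w0].
  by exists (area (map negb w)); apply: gapped_top; rewrite /isgap w0 addr0 in hw *; rewrite hw.
have nwk : ~~ within 0 k k w.
  by apply: contra nw; apply: within_weak => //; lia.
have [L [v [wE]]] := first_passage hw (lexx _) nwk.
move: hw nw w0; rewrite {}wE within_cat ycoord_cat ycoord_cons /= => hw nw w0 kL hL.
have L0 : ycoord L = 0 by lia.
move: hw nw w0; rewrite L0 addr0 /stepz add0r => /and3P[hL' _ hv] nw w0.
have hve : k%:Z + 1 + ycoord v <= k by lia.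
have nv : ~~ within 0 k (k%:Z + 1) v.
  by apply/negP => /within_start; lia.
have [w' [R [vE kw' hR]]] := last_passage hv hve nv.
have w'0 : ycoord w' = 0 by lia.
have R0 : ycoord R = 0 by move: w0; rewrite vE ycoord_cat ycoord_cons w'0 /stepz; lia.
case: (IH k.+1 w'); last first.
  by move=> a ha; exists (area (map negb L) + area (map negb R) + a)%N;
     rewrite vE; apply: gapped_step; rewrite // /isgap ?L0 ?R0 ?hL ?hR.
have kE : k.+1%:Z = k%:Z + 1 by lia.
have rE : k%:Z + r.+1 = k%:Z + 1 + r by lia.
(* The peak must lie in the middle word: [L] and [R] stay at or below level [k], so a middle word
   missing the top would make the whole word miss it. *)
move: hv nw; rewrite vE rE !within_cat /= within_cat w'0 addr0 L0 addr0 /=.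
rewrite /peaked w'0 kE eqxx andbT => /andP[-> /andP[_ _]] /=.
rewrite /stepz addr0 addrK; apply: contra => h; have /andP[_ h'] := within_start h.
by rewrite h (within_weak _ _ hL) ?(within_weak _ _ hR) //=; lia.
Qed.

Lemma isgap_peaked k w : isgap k%:Z w -> peaked k%:Z 0 w.
Proof.
rewrite /peaked addr0 => /andP[-> ->]; rewrite andbT /=.
by apply/negP => /within_start; lia.
Qed.

Lemma gapped_peaked k r w a : gapped k r w a -> peaked k%:Z r%:Z w.
Proof.
elim=> {k r w a} [k t /isgap_peaked //|k r L R w a].
move=> /andP[hL /eqP L0] /andP[hR /eqP R0] _ /and3P[hw nw /eqP w0].
have kE : k.+1%:Z = k%:Z + 1 by lia.
have rE : k%:Z + r.+1 = k%:Z + 1 + r by lia.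
move: hw nw; rewrite /peaked rE !kE => hw nw.
rewrite !within_cat /= !within_cat /= !ycoord_cat !ycoord_cons ycoord_cat ycoord_cons.
rewrite L0 R0 w0 !addr0 /stepz !addrK hw (negbTE nw) !andbF andbT.
by rewrite (within_weak _ _ hL) ?(within_weak _ _ hR) //=; lia.
Qed.

(** * Positions of the marked steps and the water between them *)

Lemma find_iota (P : pred nat) n i : (i < n)%N -> P i ->
  (forall j, (j < i)%N -> ~~ P j) -> find P (iota 0 n) = i.
Proof.
move=> ni Pi hP; have hasP : has P (iota 0 n).
  by apply/hasP; exists i; rewrite ?mem_iota.
have fn : (find P (iota 0 n) < n)%N by rewrite -[X in (_ < X)%N](size_iota 0) -has_find.
have Pf : P (find P (iota 0 n)) by have := nth_find 0%N hasP; rewrite nth_iota.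
case: (ltngtP (find P (iota 0 n)) i) => // h; first by have := hP _ h; rewrite Pf.
by have := before_find 0%N h; rewrite nth_iota // Pi.
Qed.

(** An earlier U from level [k] would take [A] above its ceiling. *)
Lemma posUE A B k : within 0 k%:Z 0 A -> ycoord A = k%:Z ->
  posU (A ++ true :: B) k.+1 = size A.
Proof.
move=> hA yA; apply: find_iota; first by rewrite size_cat /=; lia.
  by rewrite nth_cat ltnn subnn /level take_size_cat // yA /=.
move=> j jA; apply/negP => /andP[].
rewrite nth_cat jA /level takel_cat 1?ltnW // => jU /eqP /= lj.
have := withinP _ _ _ _ hA j (ltnW jA); have := withinP _ _ _ _ hA j.+1 jA.
rewrite (take_nth false jA) -cats1 ycoord_cat ycoord_cons jU ycoord_nil /stepz.
lia.
Qed.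

(** After this D the path never again reaches level k+1, where a later candidate would have to
    start. *)
Lemma posDE A B k : within 0 k%:Z k%:Z B -> ycoord A = k.+1%:Z ->
  posD (A ++ false :: B) k.+1 = size A.
Proof.
move=> hB yA; apply/eqP; rewrite eqn_leq; apply/andP; split.
  apply/bigmax_leqP => -[i /= si] /andP[]; rewrite leqNgt => iD /eqP li.
  apply/negP => Ai; have {Ai} [j iE] : exists j, i = ((size A).+1 + j)%N.
    by exists (i - (size A).+1)%N; lia.
  move: si li; rewrite /level iE size_cat /= !addSnnS ltn_add2l => jB.
  rewrite take_cat ltnNge leq_addr /= addKn /= ycoord_cat ycoord_cons yA.
  have := withinP _ _ _ _ hB j (ltnW jB); rewrite /stepz; lia.
have sA : (size A < size (A ++ false :: B))%N by rewrite size_cat /=; lia.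
apply: (leq_bigmax_cond (Ordinal sA)) => /=.
by rewrite nth_cat ltnn subnn /level take_size_cat // yA /=.
Qed.

Lemma reflected_gapE A b L B j : j = (size A + size L).+1 ->
  reflected_gap (A ++ b :: L ++ B) (size A) j = map negb L.
Proof.
move=> ->; rewrite /reflected_gap subSS addKn.
by rewrite drop_cat ltnNge leqnSn /= subSnn /= drop0 take_size_cat.
Qed.

(** The surroundings [A] and [B] are general because the induction moves [L] and [R] into them. The
    U after [A] is U_k, which starts at level m = k-1, and the left side is the part of [water] from
    level [k] upwards. *)
Lemma gapped_water k r w a : gapped k r w a -> forall (m : nat) A B, k = m.+1 ->
  within 0 m%:Z 0 A -> ycoord A = m%:Z -> within 0 m%:Z m%:Z B ->
  let s := A ++ true :: w ++ false :: B in
  (\sum_(k <= j < k + r)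
      (area (reflected_gap s (posU s j) (posU s j.+1)) +
       area (reflected_gap s (posD s j.+1) (posD s j))) +
   area (reflected_gap s (posU s (k + r)) (posD s (k + r))))%N = a.
Proof.
have posDE' A' w' B' k' : within 0 k'%:Z k'%:Z B' -> ycoord (A' ++ true :: w') = k'.+1%:Z ->
    posD (A' ++ true :: w' ++ false :: B') k'.+1 = (size A' + size w').+1.
  by move=> hB yA; have := posDE hB yA; rewrite -catA size_cat /= addnS.
elim=> {k r w a} [k t|k r L R w a].
  move=> /andP[ht /eqP t0] m A B km hA yA hB /=.
  rewrite addn0 big_geq // add0n km posUE // posDE' ?ycoord_cat ?ycoord_cons ?t0 ?yA //.
    by rewrite reflected_gapE.
  by rewrite /stepz; lia.
move=> /andP[hL /eqP L0] /andP[hR /eqP R0] gw IH m A B km hA yA hB s.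
have /and3P[_ _ /eqP w0] := gapped_peaked gw.
(* The same path regrouped around U_(k+1) and D_(k+1). *)
have sE : s = (A ++ true :: L) ++ true :: w ++ false :: R ++ false :: B.
  by rewrite /s -!catA /= -!catA.
have yA' : ycoord (A ++ true :: L) = m.+1%:Z.
  by rewrite ycoord_cat ycoord_cons yA L0 /stepz; lia.
have m1 : m%:Z + stepz true = m.+1%:Z by rewrite /stepz; lia.
have hA' : within 0 m.+1%:Z 0 (A ++ true :: L).
  rewrite within_cat yA add0r /= m1 -km hL (within_weak _ _ hA) //=; lia.
have hB' : within 0 m.+1%:Z m.+1%:Z (R ++ false :: B).
  rewrite within_cat R0 addr0 -km hR /= km (_ : _ + _ = m%:Z); last by rewrite /stepz; lia.
  rewrite (within_weak _ _ hB) //=; lia.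
have := IH m.+1 _ _ (congr1 succn km) hA' yA' hB'.
rewrite /= -sE => {IH} IH.
rewrite -addSnnS big_ltn; last by lia.
rewrite -addnA IH; congr (_ + _)%N.
have U1 : posU s k = size A by rewrite km posUE.
have U2 : posU s k.+1 = (size A + size L).+1.
  by rewrite km sE posUE // size_cat /= addnS.
have yA2 : ycoord ((A ++ true :: L) ++ true :: w) = m.+2%:Z.
  by rewrite ycoord_cat ycoord_cons yA' w0 /stepz; lia.
have D2 : posD s k.+1 = size ((A ++ true :: L) ++ true :: w).
  by rewrite km sE posDE' // !size_cat /= !addnS; lia.
have D1 : posD s k = (size ((A ++ true :: L) ++ true :: w) + size R).+1.
  rewrite km /s posDE' //; first by rewrite !size_cat /= !size_cat /=; lia.
  rewrite ycoord_cat !ycoord_cons ycoord_cat !ycoord_cons ycoord_cat ycoord_cons.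
  by rewrite yA L0 R0 w0 /stepz; lia.
rewrite U1 U2 D1 D2; congr (area _ + area _)%N.
  by rewrite /s -!catA /= reflected_gapE.
by rewrite sE -cat_cons catA /= reflected_gapE.
Qed.

(** Gaps at level 0 are empty, so the outermost steps are U_1 and D_1, and nothing is lost by
    [water] starting at level 1. *)
Lemma gapped0_water h s a : gapped 0 h s a -> height s = h -> water s = a.
Proof.
have nil v : isgap 0 v -> v = [::].
  by case: v => [|b v] // /andP[/andP[_ /within_start]]; rewrite /stepz; case: b.
move=> g; inversion g as [k t hs|k r L R w b gL gR gw]; subst => hE.
  by rewrite (nil _ hs) in hE *; rewrite /water hE areaE.
have := gapped_water gw (m := 0) (A := [::]) (B := [::]) erefl.
rewrite /water hE (nil _ gL) (nil _ gR) /= add1n.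
by rewrite (areaE [::]) !add0n; apply=> //; apply: ycoord_nil.
Qed.

End Paths.

(** * Generating functions of words *)

Section WeightedSums.
Variable F : fieldType.
Implicit Types (f g : seq bool -> F) (s u v w : seq bool).

(** The sum over all words of length [n], branching on the first letter so that words can be cut by
    induction. *)
Fixpoint wsum n f : F :=
  if n is n'.+1 then wsum n' (fun s => f (true :: s)) + wsum n' (fun s => f (false :: s))
  else f [::].

Lemma eq_wsum n f g : (forall s, size s = n -> f s = g s) -> wsum n f = wsum n g.
Proof.
elim: n f g => [|n IH] f g fg /=; first exact: fg.
by congr (_ + _); apply: IH => s sn; apply: fg; rewrite /= sn.
Qed.

Lemma wsum_eq0 n f : (forall s, size s = n -> f s = 0) -> wsum n f = 0.
Proof.
elim: n f => [|n IH] f f0 /=; first exact: f0.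
by rewrite !IH ?addr0 // => s sn; apply: f0; rewrite /= sn.
Qed.

Lemma wsumZ n a f : wsum n (fun s => a * f s) = a * wsum n f.
Proof. by elim: n f => [|n IH] f //=; rewrite !IH mulrDr. Qed.

Lemma wsumD n f g : wsum n (fun s => f s + g s) = wsum n f + wsum n g.
Proof. by elim: n f g => [|n IH] f g //=; rewrite !IH addrACA. Qed.

Lemma wsum_sum n (I : Type) (r : seq I) (f : I -> seq bool -> F) :
  wsum n (fun s => \sum_(i <- r) f i s) = \sum_(i <- r) wsum n (f i).
Proof.
elim: n f => [|n IH] f //=; rewrite !IH -big_split; exact: eq_bigr.
Qed.

Lemma wsum_tuple n f : \sum_(s : n.-tuple bool) f s = wsum n f.
Proof.
elim: n f => [|n IH] f /=.
  by rewrite (bigD1 [tuple]) //= big1 ?addr0 // => t /eqP[]; rewrite (tuple0 t).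
rewrite (reindex (fun x : bool * n.-tuple bool => [tuple of x.1 :: x.2])) /=; last first.
  exists (fun t : n.+1.-tuple bool => (thead t, [tuple of behead t])) => [[b t]|t] _ /=.
    by congr (_, _); apply: val_inj.
  by rewrite [RHS]tuple_eta; apply: val_inj.
rewrite -(pair_bigA _ (fun b (t : n.-tuple bool) => f (b :: t))) /=.
by rewrite big_bool /= (IH (fun s => f (true :: s))) (IH (fun s => f (false :: s))).
Qed.

(** The marked concatenation product: the sum of [f u * g v] over all factorizations of [s] as [u],
    the letter [b], then [v]. *)
Fixpoint cut b f g s : F :=
  if s is c :: s' then
    (if c == b then f [::] * g s' else 0) + cut b (fun u => f (c :: u)) g s'
  else 0.

Lemma cut_neq0 b f g s : cut b f g s != 0 ->
  exists u v, [/\ s = u ++ b :: v, f u != 0 & g v != 0].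
Proof.
elim: s f => [|c s IH] f /=; first by rewrite eqxx.
have [/IH [u [v [-> fu gv]]] _|/negPn/eqP->] := boolP (cut b (fun u => f (c :: u)) g s != 0).
  by exists (c :: u), v.
rewrite addr0; case: (c =P b) => [->|_]; last by rewrite eqxx.
by rewrite mulf_eq0 negb_or => /andP[f0 g0]; exists [::], s.
Qed.

(** If only one factorization has nonzero weight, the sum reduces to that term. *)
Lemma cut_at b f g u v :
  (forall u' v', u ++ b :: v = u' ++ b :: v' -> f u' != 0 -> g v' != 0 -> u' = u) ->
  cut b f g (u ++ b :: v) = f u * g v.
Proof.
elim: u f => [|c u IH] f uniq /=.
  rewrite eqxx [X in _ + X](_ : _ = 0) ?addr0 //; apply/eqP/negPn/negP.
  by case/cut_neq0 => u' [v' [e fu gv]]; have := uniq (b :: u') v'; rewrite e => /(_ erefl fu gv).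
rewrite IH; last first.
  move=> u' v' e fu gv; have := uniq (c :: u') v'.
  by rewrite /= e => /(_ erefl fu gv) [].
rewrite [X in X + _](_ : _ = 0) ?add0r //; case: (c =P b) => // cb.
apply/eqP; rewrite mulf_eq0; apply/orP.
case: (f [::] =P 0) => [_|/eqP f0]; [by left | right]; apply/negPn/negP => g0.
by have := uniq [::] (u ++ b :: v); rewrite cb => /(_ erefl f0 g0).
Qed.

Lemma wsum_cut b n f g :
  wsum n.+1 (cut b f g) = \sum_(i < n.+1) wsum i f * wsum (n - i) g.
Proof.
elim: n f => [|n IH] f.
  by rewrite big_ord1 /=; case: b; rewrite /= ?addr0 ?add0r.
have E c : wsum n.+1 (fun s => cut b f g (c :: s)) =
    (if c == b then f [::] * wsum n.+1 g else 0)
    + \sum_(i < n.+1) wsum i (fun u => f (c :: u)) * wsum (n - i) g.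
  rewrite wsumD -IH; congr (_ + _).
  by case: eqP => _; [rewrite wsumZ | rewrite wsum_eq0].
rewrite [LHS](_ : _ = wsum n.+1 (fun s => cut b f g (true :: s)) +
   wsum n.+1 (fun s => cut b f g (false :: s))) // !E.
rewrite addrACA -big_split [RHS]big_ord_recl subn0; congr (_ + _).
  by case: (b); rewrite /= ?addr0 ?add0r.
by apply: eq_bigr => i _; rewrite /= -mulrDl.
Qed.

Definition evenly f := forall s, odd (size s) -> f s = 0.

Lemma sum_double (u : nat -> F) n : (forall i, odd i -> u i = 0) ->
  \sum_(i < n.*2.+1) u i = \sum_(i < n.+1) u i.*2.
Proof.
move=> u0; elim: n => [|n IH]; first by rewrite !big_ord1.
rewrite doubleS big_ord_recr big_ord_recr /= IH [RHS]big_ord_recr /=.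
by rewrite [u n.*2.+1]u0 ?addr0 //= odd_double.
Qed.

Lemma sum_doubleS (u : nat -> F) n : (forall i, odd i -> u i = 0) ->
  \sum_(i < n.*2.+2) u i = \sum_(i < n.+1) u i.*2.
Proof.
by move=> u0; rewrite big_ord_recr /= sum_double // u0 ?addr0 //= odd_double.
Qed.

(** Here [x] marks pairs of steps; [oddgf] leaves one letter uncounted, typically the marked one. *)
Definition evengf f : fps F := FPS (fun n => wsum n.*2 f).
Definition oddgf f : fps F := FPS (fun n => wsum n.*2.+1 f).

Lemma wsum_odd f n : evenly f -> odd n -> wsum n f = 0.
Proof. by move=> ef on; apply: wsum_eq0 => s sn; apply: ef; rewrite sn. Qed.

Lemma oddgf_cut b f g : evenly f -> oddgf (cut b f g) = evengf f * evengf g.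
Proof.
move=> ef; apply: fpsP => n; transitivity (wsum n.*2.+1 (cut b f g)) => //; rewrite wsum_cut.
rewrite (sum_double (u := fun i => wsum i f * wsum (n.*2 - i) g)); last first.
  by move=> i oi; rewrite wsum_odd ?mul0r.
by apply: eq_bigr => i _; rewrite -doubleB.
Qed.

Lemma coefs_XM0 (f : fps F) : coefs (fpsX F * f) 0 = 0.
Proof. by rewrite /= big_ord1 mul0r. Qed.

Lemma coefs_XMS (f : fps F) n : coefs (fpsX F * f) n.+1 = coefs f n.
Proof.
rewrite /= big_ord_recl mul0r add0r big_ord_recl /= mul1r subn1 big1 ?addr0 //.
by move=> i _; rewrite mul0r.
Qed.

(** The marked letter and the odd letter of the second factor together form one more pair, hence the
    factor [x]. *)
Lemma evengf_cut b f g : evenly f -> evengf (cut b f g) = fpsX F * (evengf f * oddgf g).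
Proof.
move=> ef; apply: fpsP => -[|n]; first by rewrite coefs_XM0.
rewrite coefs_XMS; transitivity (wsum n.*2.+2 (cut b f g)) => //; rewrite wsum_cut.
rewrite (sum_doubleS (u := fun i => wsum i f * wsum (n.*2.+1 - i) g)); last first.
  by move=> i oi; rewrite wsum_odd ?mul0r.
apply: eq_bigr => i _; rewrite (_ : n.*2.+1 - i.*2 = (n - i).*2.+1)%N //.
by have := ltn_ord i; lia.
Qed.

Lemma evengfZ a f : evengf (fun s => a * f s) = a *: evengf f.
Proof. by apply: fpsP => n; apply: wsumZ. Qed.

End WeightedSums.

(** * Gaps and peaks *)

Lemma cat_marked_eq (T : Type) (b : T) u v u' v' : u ++ b :: v = u' ++ b :: v' ->
  [\/ u = u', exists x, u' = u ++ b :: x /\ v = x ++ b :: v' |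
      exists x, u = u' ++ b :: x /\ v' = x ++ b :: v].
Proof.
elim: u u' => [|c u IH] [|c' u'] /= [].
- by constructor 1.
- by move=> <- ->; constructor 2; exists u'.
- by move=> -> <-; constructor 3; exists u.
move=> -> /IH[->|[x [-> ->]]|[x [-> ->]]].
- by constructor 1.
- by constructor 2; exists x.
- by constructor 3; exists x.
Qed.

(** A U right after a gap rises above its ceiling, so it cannot lie inside a longer gap. *)
Lemma isgap_first_uniq (k : int) u v u' v' :
  u ++ true :: v = u' ++ true :: v' -> isgap k u -> isgap k u' -> u' = u.
Proof.
have no x y : isgap k (x ++ true :: y) -> ycoord x = 0 -> False.
  move=> /andP[]; rewrite within_cat => /andP[_] h _ x0; move: h.
  by rewrite x0 addr0 /= /stepz => /andP[_ /within_start]; lia.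
move=> e gu gu'; have /andP[_ /eqP u0] := gu; have /andP[_ /eqP u'0] := gu'.
case: (cat_marked_eq e) => [->//|[x [u'E _]]|[x [uE _]]].
  by case: (no u x); rewrite // -u'E.
by case: (no u' x); rewrite // -uE.
Qed.

(** Otherwise the portion between the two D steps would gain one level and break the ceiling of the
    gap containing it. *)
Lemma isgap_last_uniq (k : int) u v u' v' : u ++ false :: v = u' ++ false :: v' ->
  ycoord u = 0 -> ycoord u' = 0 -> isgap k v -> isgap k v' -> u' = u.
Proof.
have no u1 x y : isgap k (x ++ false :: y) -> ycoord u1 = 0 ->
    ycoord (u1 ++ false :: x) = 0 -> False.
  move=> /andP[]; rewrite within_cat => /andP[/within_end h _] _ u0; move: h.
  by rewrite ycoord_cat ycoord_cons u0 /stepz; lia.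
move=> e u0 u'0 gv gv'.
case: (cat_marked_eq e) => [->//|[x [u'E vE]]|[x [uE v'E]]].
  by case: (no u x v'); rewrite -?u'E -?vE.
by case: (no u' x v); rewrite -?uE -?v'E.
Qed.

Lemma isgap0 v : isgap 0 v = (v == [::]).
Proof.
case: v => [|b v]; first by rewrite /isgap ycoord_nil.
by apply/negP => /andP[/andP[_ /within_start]]; rewrite /stepz; case: b.
Qed.

(** First-return decomposition: cut at the first U back to level k+1. *)
Lemma isgap_D k v : isgap k.+1%:Z (false :: v) ->
  exists A B, [/\ v = A ++ true :: B, isgap k%:Z A & isgap k.+1%:Z B].
Proof.
have kE : k.+1%:Z + stepz false = k%:Z by rewrite /stepz; lia.
have kE' : k%:Z + stepz true = k.+1%:Z by rewrite /stepz; lia.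
move=> /andP[/= /andP[_]]; rewrite kE ycoord_cons => hv /eqP yv.
have nv : ~~ within 0 k k v.
  by apply/negP => /within_end; move: yv; rewrite /stepz; lia.
have [A [B [vE yA hA]]] := first_passage hv (lexx _) nv.
have A0 : ycoord A = 0 by lia.
exists A, B; split=> //; rewrite /isgap ?A0 ?hA //.
move: hv yv; rewrite vE within_cat ycoord_cat ycoord_cons A0 addr0 /= kE'.
by move=> /andP[_ /andP[_ ->]]; rewrite /stepz; lia.
Qed.

Lemma isgap_DU k A B : isgap k%:Z A -> isgap k.+1%:Z B ->
  isgap k.+1%:Z (false :: A ++ true :: B).
Proof.
have kE : k.+1%:Z + stepz false = k%:Z by rewrite /stepz; lia.
have kE' : k%:Z + stepz true = k.+1%:Z by rewrite /stepz; lia.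
move=> /andP[hA /eqP A0] /andP[hB /eqP B0].
rewrite /isgap /= within_cat /= !(ycoord_cons, ycoord_cat) A0 B0 kE addr0 kE' hB.
by rewrite (within_weak _ _ hA) //; rewrite /stepz; lia.
Qed.

(** * Weights of gaps and peaks, and the continued fraction *)

Section GapWeights.
Variables (F : fieldType) (p q : F).
Implicit Types (c : F) (s u v w : seq bool).

(* The extra weight [c] per step absorbs the change of variable [x -> p^2 x]
   that the first-return decomposition produces. *)
Definition gapw (k : nat) c w : F :=
  if isgap k w then
    c ^+ size w * p ^+ area (map negb w) * q ^+ asum k w
  else 0.

Lemma gapw_neq0 k c w : gapw k c w != 0 -> isgap k w.
Proof. by rewrite /gapw; case: ifP => //; rewrite eqxx. Qed.

Lemma gapw_evenly k c : evenly (gapw k c).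
Proof.
move=> s os; apply/eqP/negPn/negP => /gapw_neq0 /andP[_ /eqP /ycoord_even].
by rewrite os.
Qed.

Lemma gapw_cat k c L R (f : seq bool -> F) (g : seq bool -> F) :
  isgap k%:Z L -> cut true (gapw k c) f (L ++ true :: R) = gapw k c L * f R.
Proof.
move=> hL; apply: cut_at => u' v' e /gapw_neq0 gu' _.
exact: isgap_first_uniq e hL gu'.
Qed.

(** The outer D and U start at levels k+1 and k, giving q^(2k+1); their reflections start at heights
    0 and 1, giving [p]. The reflection of the inner gap is raised by one, which turns its step
    weight [c] into [c * p]. *)
Lemma gapw_D k c v : gapw k.+1 c (false :: v) =
  c ^+ 2 * p * q ^+ (k.*2.+1) * cut true (gapw k (c * p)) (gapw k.+1 c) v.
Proof.
have [/isgap_D [A [B [-> gA gB]]]|ng] := boolP (isgap k.+1%:Z (false :: v)).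
  rewrite gapw_cat // /gapw gA gB isgap_DU // {1}areaE /= !map_cat /=.
  rewrite !(size_cat, asum_cat) /=.
  have kE : k.+1%:Z + stepz false = k%:Z by rewrite /stepz; lia.
  have kE' : k%:Z + stepz true = k.+1%:Z by rewrite /stepz; lia.
  have /andP[hA /eqP A0] := gA.
  have := asum_neg_shift hA; rewrite subrr => ->.
  rewrite ycoord_neg A0 oppr0 !addr0 kE kE' !areaE add0r.
  have -> : 0 + stepz true + stepz (~~ true) = 0 :> int by [].
  rewrite /= -!areaE -addnn !exprMn !(exprD, exprS) !expr0; ring.
rewrite /gapw (negbTE ng); apply/esym/eqP; rewrite mulf_eq0; apply/orP; right.
apply/negPn/negP => /cut_neq0 [A [B [vE /gapw_neq0 gA /gapw_neq0 gB]]].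
by move: ng; rewrite vE isgap_DU.
Qed.

Lemma evengf_gapw0 c : evengf (gapw 0 c) = 1.
Proof.
apply: fpsP => -[|n].
  by rewrite /= /gapw isgap0 eqxx areaE /= !mulr1.
apply: (wsum_eq0 (n := n.*2.+2)) => s sn; rewrite /gapw isgap0.
by case: s sn.
Qed.

(** A gap is empty or begins with D; the 2n+1 letters after that D are counted by [oddgf]. *)
Lemma evengf_gapwS k c : evengf (gapw k.+1 c) =
  1 + (c ^+ 2 * p * q ^+ (k.*2.+1)) *:
      (fpsX F * (evengf (gapw k (c * p)) * evengf (gapw k.+1 c))).
Proof.
apply: fpsP => -[|n].
  rewrite [RHS]/= big_ord1 mul0r mulr0 addr0 /= /gapw /isgap /= ycoord_nil.
  by rewrite lexx eqxx areaE /= !mulr1.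
rewrite -(oddgf_cut true); last exact: gapw_evenly.
transitivity (0 + c ^+ 2 * p * q ^+ k.*2.+1 *
  coefs (fpsX F * oddgf (cut true (gapw k (c * p)) (gapw k.+1 c))) n.+1) => //.
rewrite coefs_XMS add0r -wsumZ.
transitivity (wsum n.*2.+2 (gapw k.+1 c)) => //.
transitivity (wsum n.*2.+1 (fun s => gapw k.+1 c (true :: s)) +
              wsum n.*2.+1 (fun s => gapw k.+1 c (false :: s))) => //.
rewrite wsum_eq0 ?add0r; last first.
  move=> s _; rewrite /gapw ifN //; apply/negP => /andP[/andP[_ /within_start]].
  by rewrite /stepz; lia.
by apply: eq_wsum => s _; rewrite gapw_D.
Qed.

(** The convergents of the continued fraction, with the denominator cleared. The weight [c] must
    stay general, since the induction step uses [c * p]. *)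
Lemma mul_gapw_Ppoly k c : p != 0 -> q != 0 ->
  evengf (gapw k c) *
    Ppoly k.+1 ((c ^+ 2 * p * q ^ (2 * k%:Z - 1)) *: fpsX F) (p ^+ 2 / q ^+ 2)%:A =
  Ppoly k ((c ^+ 2 * p ^+ 3 * q ^ (2 * k%:Z - 3)) *: fpsX F) (p ^+ 2 / q ^+ 2)%:A.
Proof.
move=> p0 q0; elim: k c => [|k IH] c.
  by rewrite evengf_gapw0 /Ppoly !big_ord1 !expr0 !mul1r.
rewrite Ppoly_rec -[(_%:A) ^+ 2](rmorphXn (in_alg (fps F))) /= !mulr_algr !scalerA.
set b : F := p ^+ 2 / q ^+ 2; set a := c ^+ 2 * p * q ^ (2 * k.+1%:Z - 1).
(* Integer exponents become quotients of natural powers, within reach of [ring] and [field]. *)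
have qz j : q ^ (k.*2.+1%:Z - j%:Z) = q ^+ k.*2.+1 / q ^+ j.
  by rewrite expfzDr // -exprnN.
have aE : a = c ^+ 2 * p * q ^+ k.*2.+1.
  by rewrite /a (_ : 2 * _ - 1 = k.*2.+1%:Z) //; lia.
have abE : b * a = (c * p) ^+ 2 * p * q ^ (2 * k%:Z - 1).
  rewrite (_ : 2 * _ - 1 = k.*2.+1%:Z - 2%N%:Z); last by lia.
  by rewrite qz aE /b; ring.
have abbE : b ^+ 2 * a = (c * p) ^+ 2 * p ^+ 3 * q ^ (2 * k%:Z - 3).
  rewrite (_ : 2 * _ - 3 = k.*2.+1%:Z - 4%N%:Z); last by lia.
  by rewrite qz aE /b; field.
have cE : c ^+ 2 * p ^+ 3 * q ^ (2 * k.+1%:Z - 3) = b * a.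
  rewrite (_ : 2 * _ - 3 = k.*2.+1%:Z - 2%N%:Z); last by lia.
  by rewrite qz aE /b; ring.
have := evengf_gapwS k c; have := IH (c * p).
rewrite -/b cE abE abbE -aE -scalerAl mulrBr => <-.
set D := Ppoly k.+1 _ _; set G1 := evengf (gapw k _); set G2 := evengf _ => G2E.
(* With the first-return equation read as 1 = G2 - a x G1 G2, both sides are this difference times
   [D]. *)
rewrite -[X in _ = X]mul1r; have -> : 1 = G2 - a *: (fpsX F * (G1 * G2)) by rewrite {1}G2E addrK.
rewrite mulrBl -!scalerAl -!scalerAr; congr (_ - _ *: _); ring.
Qed.

(** The factor q^(2k+1) is the area of U_(k+1) and D_(k+1), which start at levels k and k+1. *)
Fixpoint peakw r k w : F :=
  if r is r'.+1 then
    q ^+ k.*2.+1 * cut true (gapw k 1) (cut false (peakw r' k.+1) (gapw k 1)) w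
  else gapw k 1 w.

Lemma peakw_neq0 r k w : peakw r k w != 0 -> exists a, gapped k r w a.
Proof.
elim: r k w => [|r IH] k w /=.
  by move/gapw_neq0 => h; exists (area (map negb w)); apply: gapped_top.
rewrite mulf_eq0 negb_or => /andP[_ /cut_neq0 [L [v [-> /gapw_neq0 gL]]]].
case/cut_neq0 => w' [R [-> /IH [a ga] /gapw_neq0 gR]].
by exists (area (map negb L) + area (map negb R) + a)%N; apply: gapped_step.
Qed.

Lemma gapped_ycoord k r w a : gapped k r w a -> ycoord w = 0.
Proof. by case/gapped_peaked/and3P => _ _ /eqP. Qed.

Lemma peakw_evenly r k : evenly (peakw r k).
Proof.
move=> s os; apply/eqP/negPn/negP => /peakw_neq0 [a /gapped_ycoord /ycoord_even].
by rewrite os.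
Qed.

Lemma peakw_gapped r k w a : gapped k r w a -> peakw r k w = p ^+ a * q ^+ asum k w.
Proof.
elim=> {k r w a} [k t gt|k r L R w a gL gR gw IH] /=.
  by rewrite /gapw gt expr1n mul1r.
rewrite gapw_cat // cut_at; last first.
  move=> u' v' e /peakw_neq0 [a' ga'] /gapw_neq0 gv'.
  exact: isgap_last_uniq e (gapped_ycoord gw) (gapped_ycoord ga') gR gv'.
rewrite IH /gapw gL gR !expr1n !mul1r !asum_cat /= asum_cat /=.
have w0 := gapped_ycoord gw; have /andP[_ /eqP L0] := gL.
have kE : k%:Z + stepz true = k.+1%:Z by rewrite /stepz; lia.
have kE' : k.+1%:Z + stepz false = k%:Z by rewrite /stepz; lia.
rewrite L0 w0 !addr0 kE kE' /= -addnn !(exprD, exprS); ring.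
Qed.

(** Each level below the peak has a left and a right gap, hence the squares. The exponent of [q] is
    the sum of 2(k+j)+1 over j < r. *)
Lemma evengf_peakw r k : evengf (peakw r k) =
  q ^+ (r * (k.*2 + r)) *: (fpsX F ^+ r *
    ((\prod_(j < r) evengf (gapw (k + j) 1) ^+ 2) * evengf (gapw (k + r) 1))).
Proof.
elim: r k => [|r IH] k.
  by rewrite mul0n !expr0 big_ord0 !mul1r scale1r addn0.
rewrite evengfZ evengf_cut; last exact: gapw_evenly.
rewrite oddgf_cut; last exact: peakw_evenly.
rewrite IH big_ord_recl addn0 -[(k + r.+1)%N]addSnnS.
rewrite [in RHS](eq_bigr (fun j : 'I_r => evengf (gapw (k.+1 + j) 1) ^+ 2)); last first.
  by move=> j _; rewrite lift0 addnS addSn.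
have -> : (r.+1 * (k.*2 + r.+1) = k.*2.+1 + r * (k.+1.*2 + r))%N by lia.
rewrite -!scalerAl -!scalerAr scalerA -exprD; congr (_ *: _).
rewrite exprS; ring.
Qed.

(** * Paths of given height and the telescoping quotient *)

Lemma dyck_height_peaked h s : is_dyck s && (height s == h) = peaked 0 h s.
Proof.
rewrite /peaked add0r; case: h => [|h].
  rewrite -leqn0 height_leE; case: (ycoord s == 0); rewrite ?andbF // !andbT.
  case: (within 0 0 0 s) => //=; apply/esym/negP => /within_start; lia.
have -> : is_dyck s && (height s == h.+1) =
    (is_dyck s && (height s <= h.+1)%N) && ~~ (is_dyck s && (height s <= h)%N).
  by case: (is_dyck s); rewrite //= eqn_leq -ltnNge.
rewrite !height_leE (_ : h.+1%:Z - 1 = h%:Z); last by lia.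
by case: (ycoord s == 0); rewrite ?andbF ?andbT.
Qed.

Lemma peakw_dyck h s : peakw h 0 s =
  if is_dyck s && (height s == h) then p ^+ water s * q ^+ area s else 0.
Proof.
rewrite dyck_height_peaked; case: ifP => [hs|/negP hs].
  have [a ga] := peaked_gapped hs.
  have /andP[_ /eqP h_s] : is_dyck s && (height s == h) by rewrite dyck_height_peaked.
  by rewrite (peakw_gapped ga) (gapped0_water ga h_s) areaE.
by apply/eqP/negPn/negP => /peakw_neq0 [a /gapped_peaked].
Qed.

Lemma G_evengf N y : G N y p q = \sum_(0 <= h < N.+1) y ^+ h *: evengf (peakw h 0).
Proof.
apply: fpsP => n.
have coefs_sum (f : nat -> fps F) M :
    coefs (\sum_(0 <= h < M) f h) n = \sum_(0 <= h < M) coefs (f h) n.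
  by apply: (big_morph (fun g : fps F => coefs g n)).
rewrite coefs_sum [LHS]/= big_mkcond /=.
transitivity (\sum_(0 <= h < N.+1) wsum n.*2 (fun s => y ^+ h * peakw h 0 s)); last first.
  by apply: eq_bigr => h _; rewrite wsumZ.
rewrite -wsum_sum -wsum_tuple; apply: eq_bigr => s _.
(* Each word contributes only at the index equal to its height. *)
rewrite (eq_bigr (fun h => if h == height s then
   (if is_dyck s then y ^+ height s * p ^+ water s * q ^+ area s else 0) else 0)).
  rewrite -big_mkcond big_nat1_eq ltnS /= andbC.
  by case: (_ <= _)%N; case: (is_dyck s).
move=> h _; rewrite peakw_dyck eq_sym; case: eqP => [->|_].
  by rewrite andbT; case: ifP; rewrite ?mulr0 ?mulrA.
by rewrite andbF mulr0.
Qed.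

(** Each gap series is [N k / D k.+1]. The factor [D 0] is 1, so the denominators of these quotients
    multiply to R_h(x) and the numerators to R_(h-1)(p^2 x). *)
Lemma Rpoly_ratio h : p != 0 -> q != 0 ->
  Rpoly (h%:Z - 1) (p ^+ 2 *: fpsX F) p q / Rpoly h%:Z (fpsX F) p q =
  (\prod_(j < h) evengf (gapw j 1) ^+ 2) * evengf (gapw h 1).
Proof.
move=> p0 q0.
pose b : F := p ^+ 2 / q ^+ 2.
pose D k := Ppoly k ((q ^ (2 * k%:Z - 3) * p) *: fpsX F) b%:A.
pose N k := Ppoly k ((q ^ (2 * k%:Z - 3) * p) *: (p ^+ 2 *: fpsX F)) b%:A.
have DN k : evengf (gapw k 1) * D k.+1 = N k.
  have := mul_gapw_Ppoly k 1 p0 q0; rewrite -/b /D /N scalerA !expr1n !mul1r.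
  have -> : 2 * k.+1%:Z - 3 = 2 * k%:Z - 1 by lia.
  by rewrite [q ^ _ * p]mulrC => ->; congr (Ppoly _ (_ *: _) _); ring.
have D0 : D 0%N = 1 by rewrite /D /Ppoly big_ord1 !expr0 !mul1r.
have N0 : N 0%N = 1 by rewrite /N /Ppoly big_ord1 !expr0 !mul1r.
have RE : Rpoly h%:Z (fpsX F) p q = (\prod_(k < h) D k.+1 ^+ 2) * D h.+1.
  by rewrite RpolyE big_ord_recl -/(D 0%N) D0 expr1n mul1r.
have RE' : Rpoly (h%:Z - 1) (p ^+ 2 *: fpsX F) p q = (\prod_(k < h) N k ^+ 2) * N h.
  (* For h = 0 the convention R_(-1) = 1 agrees with [N 0]. *)
  case: h {RE} => [|h]; first by rewrite big_ord0 mul1r N0.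
  by rewrite (_ : h.+1%:Z - 1 = h%:Z) ?RpolyE //; lia.
have uR : Rpoly h%:Z (fpsX F) p q \is a GRing.unit.
  by rewrite -[fpsX F]scale1r Rpoly_unit.
apply: (mulIr uR); rewrite mulrVK // RE RE' -DN.
rewrite mulrACA -big_split /=; congr (_ * _).
by apply: eq_bigr => j _; rewrite -DN exprMn.
Qed.

End GapWeights.

Theorem mainTheorem3 (F : fieldType) (p q : F) (hpq : p * q != 0) :
  (forall h : nat, Rpoly h%:Z (fpsX F) p q = Rpoly h%:Z (fpsX F) q p) /\
  (forall (N : nat) (y : F),
     G N y p q =
     \sum_(0 <= h < N.+1)
       (y ^+ h * q ^+ (h ^ 2)) *: (fpsX F ^+ h *
         (Rpoly (h%:Z - 1) (p ^+ 2 *: fpsX F) p q / Rpoly h%:Z (fpsX F) p q))).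
Proof.
have [p0 q0] : p != 0 /\ q != 0 by apply/andP; rewrite -negb_or -mulf_eq0.
split=> [h|N y].
  rewrite !RpolyE Ppoly_sym //; congr (_ * _).
  by apply: eq_bigr => k _; rewrite Ppoly_sym.
rewrite G_evengf; apply: eq_bigr => h _.
by rewrite evengf_peakw Rpoly_ratio // scalerA add0n mulnn.
Qed.
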